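(* Let $f$ be a smooth $2\pi$-periodic function with $\int_0^{2\pi} f(x)\,dx=0$, let $u_0$ be a smooth $2\pi$-periodic function with $u_0(x)<0$ and $u_0(x)u_0'(x)=f(x)$ for all $x$, let $n$ be a positive integer, and let $u_1,\dots,u_n$ and $F$ (which depends on $\varepsilon$) be as defined in the context. Then there exist $\varepsilon_0>0$ and a constant $C>0$, where $C$ depends on $n$ but is independent of $\varepsilon$, such that for every $0<\varepsilon<\varepsilon_0$ the equation $$-g''(y)+\varepsilon^{n+1}g(y)g'(y)+\Big(\sum_{k=0}^n\varepsilon^k u_k(\varepsilon y)\Big)g'(y)+\Big(\sum_{k=0}^n\varepsilon^{k+1}u_k'(\varepsilon y)\Big)g(y)+F(\varepsilon y)=0$$ has a solution $g\in C^2([0,\tfrac{2\pi}{\varepsilon}])$ satisfying $$g(0)=g\big(\tfrac{2\pi}{\varepsilon}\big)\qquad\text{and}\qquad |g(y)|\le C\ \text{ for all } y\in[0,\tfrac{2\pi}{\varepsilon}].$$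
   Context: All functions are real-valued. Given $u_0$ smooth, $2\pi$-periodic and everywhere negative, the functions $u_k$, $k\ge 1$, are defined recursively by $$u_0(x)u_k(x)=u_{k-1}'(x)-\frac12\sum_{\substack{i+j=k\\ i,j\ge 1}}u_i(x)u_j(x),\qquad k=1,2,\dots$$ (for $k=1$ the sum is empty); each $u_k$ is smooth and $2\pi$-periodic. For fixed $n$ and $\varepsilon$, $$F(x)=\sum_{k=1}^{n}\varepsilon^k\big(u_k(x)u_n'(x)+u_{k+1}(x)u_{n-1}'(x)+\cdots+u_n(x)u_k'(x)\big)-\varepsilon u_n''(x).$$ In the equation, $u_k'(\varepsilon y)$ denotes the derivative $u_k'$ evaluated at $\varepsilon y$. The constants $\varepsilon_0$ and $C$ may depend on $f$, $u_0$ and $n$. *)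

(* Defs.v *)
From Stdlib Require Import Reals.
From Coquelicot Require Import Coquelicot.
Open Scope R_scope.

Definition smooth (f : R -> R) : Prop :=
  forall (m : nat) (x : R), ex_derive_n f m x.

Definition periodic2PI (f : R -> R) : Prop :=
  forall x : R, f (x + 2 * PI) = f x.

(* For k = 1 the index range 1..0 is empty and [sum_n_m] returns 0. *)
Definition expansion_coeffs (u0 : R -> R) (u : nat -> R -> R) : Prop :=
  (forall x : R, u 0%nat x = u0 x) /\
  (forall (k : nat) (x : R), (1 <= k)%nat ->
     u0 x * u k x =
       Derive (u (k - 1)%nat) x
       - 1 / 2 * sum_n_m (fun i : nat => u i x * u (k - i)%nat x) 1 (k - 1)).

(* The inner sum is u_k u_n' + u_(k+1) u_(n-1)' + ... + u_n u_k'. *)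
Definition remainder_F (u : nat -> R -> R) (n : nat) (eps x : R) : R :=
  sum_n_m (fun k : nat =>
    eps ^ k *
      sum_n_m (fun j : nat => u j x * Derive (u (n + k - j)%nat) x) k n) 1 n
  - eps * Derive_n (u n) 2 x.

(* g belongs to C^2([a,b]) with first and second derivatives g1 and g2 there.
   [D_in] and [continue_in] take limits within [a,b] only, hence one-sided
   ones at a and b; values outside [a,b] are irrelevant. *)
Definition C2_on (a b : R) (g g1 g2 : R -> R) : Prop :=
  forall y : R, a <= y <= b ->
    D_in g g1 (fun z : R => a <= z <= b) y /\
    D_in g1 g2 (fun z : R => a <= z <= b) y /\
    continue_in g2 (fun z : R => a <= z <= b) y.

(* Main.v *)
Require Import Defs.
From Stdlib Require Import Reals Arith Lra Lia FunctionalExtensionality.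
From Coquelicot Require Import Coquelicot.
Open Scope R_scope.

(** Write [U y] for the sum of [eps ^ k * u k (eps * y)] over [k <= n]. The
    left-hand side is a derivative: the second term is that of
    [eps ^ (n + 1) / 2 * g ^ 2], and the next two add up to that of [U * g].
    With [Phi] a primitive of [remainder_F u n eps (eps * y)], it is therefore enough to
    solve the Riccati equation

      [g' = U * g + Phi + eps ^ (n + 1) / 2 * g ^ 2]

    with [g 0 = g T], where [T = 2 * PI / eps]. Three facts make this possible
    with a bound on [g] that does not depend on [eps]:

    - [U] stays below a fixed [- m < 0], because [u 0] does and the other
      terms are [O(eps)] ([truncated_sum_negative]);
    - [Phi] is bounded on [0, T] by a fixed [K]: [remainder_F] is [O(eps)]
      ([remainder_F_bound]), and this compensates the length [2 * PI / eps] of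
      the interval;
    - the quadratic term has a coefficient [eps ^ (n + 1) <= eps].

    The linear problem [g' = U * g + h], [g 0 = g T], has an explicit solution,
    and a comparison argument gives [|g| <= sup |h| / m], whatever the length
    [T] ([linear_periodic_bound]). Replacing [h] by [Phi + delta / 2 * g ^ 2],
    [delta = eps ^ (n + 1)], gives a map on functions that preserves the ball
    of radius [C = (K + 1) / m] and halves distances there once [delta] is
    small with respect to [m] and [C]; its fixed point solves the Riccati
    equation ([riccati_periodic]). *)

(** * Iterated differentiability of the coefficients *)

(** The recursion puts the derivative innermost, on [f] itself, so that the
    product and quotient rules give closure by a one-step induction on [N];
    peeling [Derive_n] from the outside would need the Leibniz formula. *)
Fixpoint differentiable_times (N : nat) (f : R -> R) : Prop :=
  match N with
  | O => True
  | S N' => (forall x, ex_derive f x) /\ differentiable_times N' (Derive f)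
  end.

Lemma differentiable_times_pred N f :
  differentiable_times (S N) f -> differentiable_times N f.
Proof.
revert f; induction N as [|N IH]; intros f H; [exact I|].
destruct H as [H1 H2]; split; [exact H1|apply IH, H2].
Qed.

Lemma differentiable_times_plus N f g :
  differentiable_times N f -> differentiable_times N g ->
  differentiable_times N (fun x => f x + g x).
Proof.
revert f g; induction N as [|N IH]; intros f g; [easy|].
intros [f1 f2] [g1 g2]; split.
- intros x; now apply @ex_derive_plus.
- replace (Derive _) with (fun x => Derive f x + Derive g x); [now apply IH|].
  extensionality x; symmetry; now apply Derive_plus.
Qed.

Lemma differentiable_times_mult N f g :
  differentiable_times N f -> differentiable_times N g ->
  differentiable_times N (fun x => f x * g x).
Proof.
revert f g; induction N as [|N IH]; intros f g; [easy|].
intros Hf Hg.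
pose proof (differentiable_times_pred _ _ Hf) as f0.
pose proof (differentiable_times_pred _ _ Hg) as g0.
destruct Hf as [f1 f2], Hg as [g1 g2]; split.
- intros x; now apply ex_derive_mult.
- replace (Derive _) with (fun x => Derive f x * g x + f x * Derive g x).
  + apply differentiable_times_plus; now apply IH.
  + extensionality x; symmetry; now apply Derive_mult.
Qed.

Lemma differentiable_times_const N c : differentiable_times N (fun _ => c).
Proof.
revert c; induction N as [|N IH]; intros c; [exact I|]; split.
- intros x; apply ex_derive_const.
- replace (Derive _) with (fun _ : R => 0); [apply IH|].
  extensionality x; symmetry; apply Derive_const.
Qed.

Lemma differentiable_times_inv N f :
  (forall x, f x <> 0) ->
  differentiable_times N f -> differentiable_times N (fun x => / f x).
Proof.
intros nz; induction N as [|N IH]; [easy|].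
intros Hf; pose proof (IH (differentiable_times_pred _ _ Hf)) as Hi.
destruct Hf as [f1 f2]; split.
- intros x; now apply ex_derive_inv.
- replace (Derive _) with (fun x => -1 * (Derive f x * (/ f x * / f x))).
  + apply differentiable_times_mult; [apply differentiable_times_const|].
    apply differentiable_times_mult; [exact f2|].
    now apply differentiable_times_mult.
  + extensionality x; rewrite Derive_inv; [field|..]; auto.
Qed.

Lemma differentiable_times_sum N (f : nat -> R -> R) a b :
  (forall i, (a <= i <= b)%nat -> differentiable_times N (f i)) ->
  differentiable_times N (fun x => sum_n_m (fun i => f i x) a b).
Proof.
induction b as [|b IH]; intros Hf.
- destruct a as [|a].
  + replace (fun x => _) with (f 0%nat); [apply Hf; lia|].
    extensionality x; now rewrite sum_n_n.
  + replace (fun x => _) with (fun _ : R => 0).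
    * apply differentiable_times_const.
    * extensionality x; now rewrite sum_n_m_zero by lia.
- destruct (Nat.le_gt_cases a (S b)) as [le|lt].
  + replace (fun x => _)
      with (fun x => sum_n_m (fun i => f i x) a b + f (S b) x).
    * apply differentiable_times_plus; [|apply Hf; lia].
      apply IH; intros i Hi; apply Hf; lia.
    * extensionality x; now rewrite sum_n_Sm.
  + replace (fun x => _) with (fun _ : R => 0).
    * apply differentiable_times_const.
    * extensionality x; now rewrite sum_n_m_zero by lia.
Qed.

Lemma smooth_differentiable_times f :
  smooth f -> forall N, differentiable_times N f.
Proof.
intros Hf N; revert f Hf; induction N as [|N IH]; intros f Hf; [exact I|].
split; [exact (Hf 1%nat)|].
apply IH; intros [|m] x; [exact I|].
change (ex_derive (Derive_n (Derive_n f 1) m) x).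
apply ex_derive_ext with (Derive_n f (S m)); [|exact (Hf (S (S m)) x)].
intros t; rewrite Derive_n_comp; f_equal; lia.
Qed.

Lemma differentiable_times_continuous f :
  differentiable_times 1 f -> forall x, continuous f x.
Proof.
intros [Hf _] x; apply @ex_derive_continuous; apply Hf.
Qed.

(** [u k] is [1 / u0] times an expression in the derivative of [u (k - 1)] and
    in lower coefficients. As one derivative is lost at each step, all orders
    [N] have to be carried together through the induction on [k]. *)
Lemma expansion_coeffs_differentiable u0 u :
  smooth u0 -> (forall x, u0 x < 0) -> expansion_coeffs u0 u ->
  forall k N, differentiable_times N (u k).
Proof.
intros Hs Hneg [H0 Hrec] k.
assert (Hu0 := smooth_differentiable_times _ Hs).
induction k as [k IH] using lt_wf_ind; intros N.
destruct k as [|k].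
- replace (u 0%nat) with u0; [apply Hu0|].
  extensionality x; now rewrite H0.
- replace (u (S k)) with
    (fun x => / u0 x * (Derive (u k) x + (- (1 / 2)) *
       sum_n_m (fun i => u i x * u (S k - i)%nat x) 1 k)).
  + apply differentiable_times_mult.
    * apply differentiable_times_inv; [|apply Hu0].
      intros x; specialize (Hneg x); lra.
    * apply differentiable_times_plus.
      -- apply (IH k (Nat.lt_succ_diag_r k) (S N)).
      -- apply differentiable_times_mult; [apply differentiable_times_const|].
         apply (differentiable_times_sum N (fun i x => u i x * u (S k - i)%nat x)).
         intros i Hi; apply differentiable_times_mult; apply IH; lia.
  + extensionality x; specialize (Hneg x).
    apply (Rmult_eq_reg_l (u0 x)); [|lra].
    rewrite Hrec by lia.
    replace (S k - 1)%nat with k by lia.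
    field; lra.
Qed.

(** * Estimates uniform in eps *)

Lemma continuous_bounded (f : R -> R) a b :
  a <= b -> (forall x, continuous f x) ->
  exists B, 0 <= B /\ forall x, a <= x <= b -> Rabs (f x) <= B.
Proof.
intros ab Hf.
destruct (continuity_ab_maj (fun x => Rabs (f x)) a b ab) as [M [HM _]].
- intros c _; apply continuity_pt_filterlim.
  apply (continuous_comp f Rabs); [apply Hf|apply continuous_Rabs].
- exists (Rabs (f M)); split; [apply Rabs_pos|exact HM].
Qed.

(** Every exponent in the sum is at least [1], so one factor [eps] comes out
    and the other factors are at most [1]. *)
Lemma eps_sum_bound (s : nat -> R -> R) a b n :
  a <= b -> (forall k x, continuous (s k) x) ->
  exists B, 0 <= B /\ forall eps x, 0 <= eps <= 1 -> a <= x <= b ->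
    Rabs (sum_n_m (fun k => eps ^ k * s k x) 1 n) <= eps * B.
Proof.
intros ab Hs; induction n as [|n [B [B0 HB]]].
- exists 0; split; [lra|]; intros eps x _ _.
  rewrite sum_n_m_zero by lia; change (Rabs 0 <= eps * 0).
  rewrite Rabs_R0; lra.
- destruct (continuous_bounded (s (S n)) a b ab (Hs _)) as [B1 [B10 HB1]].
  exists (B + B1); split; [lra|]; intros eps x He Hx.
  rewrite sum_n_Sm by lia; change plus with Rplus.
  eapply Rle_trans; [apply Rabs_triang|].
  rewrite Rmult_plus_distr_l; apply Rplus_le_compat; [now apply HB|].
  rewrite Rabs_mult.
  assert (Hp : 0 <= eps ^ n <= 1).
  { split; [apply pow_le; lra|].
    rewrite <- (pow1 n); apply pow_incr; lra. }
  apply Rmult_le_compat; try apply Rabs_pos; [|now apply HB1].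
  rewrite Rabs_pos_eq; simpl; nra.
Qed.

(** * The periodic problem for a linear equation *)

Lemma is_derive_primitive (h : R -> R) y :
  (forall z, continuous h z) -> is_derive (fun y => RInt h 0 y) y (h y).
Proof.
intros Hh; apply is_derive_RInt with 0; [|apply Hh].
apply filter_forall; intros z; apply RInt_correct.
now apply @ex_RInt_continuous.
Qed.

Lemma Derive_eta (f : R -> R) y l :
  is_derive f y l -> Derive (fun t : R => f t) y = l.
Proof. exact (is_derive_unique f y l). Qed.

Lemma nonincreasing_of_derive (f df : R -> R) a b :
  (forall y, is_derive f y (df y)) ->
  (forall y, a <= y <= b -> df y <= 0) ->
  forall y z, a <= y -> y <= z -> z <= b -> f z <= f y.
Proof.
intros Hf Hdf y z Hy Hyz Hz.
destruct (MVT_gen f y z df) as [c [Hc E]].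
- intros x _; apply Hf.
- intros x _; apply continuity_pt_filterlim; apply @ex_derive_continuous.
  eexists; apply Hf.
- rewrite Rmin_left, Rmax_right in Hc by lra.
  specialize (Hdf c ltac:(lra)); nra.
Qed.

Lemma RInt_neg (U : R -> R) T m :
  0 < T -> 0 < m -> (forall y, continuous U y) ->
  (forall y, 0 <= y <= T -> U y <= - m) -> RInt U 0 T < 0.
Proof.
intros HT Hm HU Hneg.
assert (H := nonincreasing_of_derive (fun y => RInt U 0 y + m * y)
  (fun y => U y + m) 0 T).
assert (H' : RInt U 0 T + m * T <= RInt U 0 0 + m * 0).
{ apply H; try lra.
  - intros y; apply @is_derive_plus; [now apply is_derive_primitive|].
    auto_derive; [easy|ring].
  - intros y Hy; specialize (Hneg y Hy); lra. }
rewrite RInt_point in H'; change (@zero R_CompleteNormedModule) with 0 in H'; nra.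
Qed.

(** The constant [K = H / m] is a supersolution. With [P] the primitive of [U],
    the function [(g - K) * exp (- P)] is nonincreasing, while [g 0 = g T]
    makes its value at [T] that at [0] multiplied by [exp (- P T) > 1]: this is
    compatible only with [g 0 <= K], and then [g <= K] afterwards. *)
Lemma linear_periodic_upper_bound (U h g : R -> R) T m H :
  0 < T -> 0 < m -> 0 <= H -> (forall y, continuous U y) ->
  (forall y, is_derive g y (U y * g y + h y)) ->
  (forall y, 0 <= y <= T -> U y <= - m) ->
  (forall y, 0 <= y <= T -> h y <= H) ->
  g 0 = g T ->
  forall y, 0 <= y <= T -> g y <= H / m.
Proof.
intros HT Hm HH HU Hg Hneg Hh Hper.
set (K := H / m).
assert (HK : 0 <= K) by (apply Rdiv_le_0_compat; lra).
set (P := fun y => RInt U 0 y).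
assert (HP : forall y, is_derive P y (U y)).
{ intros y; now apply is_derive_primitive. }
set (q := fun y => (g y - K) * exp (- P y)).
assert (Hq : forall y, is_derive q y ((U y * K + h y) * exp (- P y))).
{ intros y; unfold q.
  assert (Dg : ex_derive g y) by (eexists; apply Hg).
  assert (DP : ex_derive P y) by (eexists; apply HP).
  auto_derive; [now repeat split|].
  rewrite (Derive_eta g _ _ (Hg y)), (Derive_eta P _ _ (HP y)); ring. }
assert (Hmon := nonincreasing_of_derive q _ 0 T Hq).
assert (Hsgn : forall y, 0 <= y <= T -> (U y * K + h y) * exp (- P y) <= 0).
{ intros y Hy; specialize (Hneg y Hy); specialize (Hh y Hy).
  assert (m * K = H) by (unfold K; field; lra).
  assert (U y * K + h y <= 0) by nra.
  assert (Hp := exp_pos (- P y)); nra. }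
specialize (Hmon Hsgn).
assert (P0 : P 0 = 0) by (unfold P; apply (RInt_point 0 U)).
assert (PT : P T < 0) by now apply RInt_neg with m.
assert (Hq0 : g 0 - K <= 0).
{ assert (HqT := Hmon 0 T ltac:(lra) ltac:(lra) ltac:(lra)).
  unfold q in HqT; rewrite <- Hper, P0, Ropp_0, exp_0 in HqT.
  assert (1 < exp (- P T)) by (rewrite <- exp_0; apply exp_increasing; lra).
  nra. }
intros y Hy.
assert (Hqy := Hmon 0 y ltac:(lra) ltac:(lra) ltac:(lra)).
unfold q in Hqy; rewrite P0, Ropp_0, exp_0 in Hqy.
assert (Hp := exp_pos (- P y)); nra.
Qed.

Lemma linear_periodic_bound (U h g : R -> R) T m H :
  0 < T -> 0 < m -> (forall y, continuous U y) ->
  (forall y, is_derive g y (U y * g y + h y)) ->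
  (forall y, 0 <= y <= T -> U y <= - m) ->
  (forall y, 0 <= y <= T -> Rabs (h y) <= H) ->
  g 0 = g T ->
  forall y, 0 <= y <= T -> Rabs (g y) <= H / m.
Proof.
intros HT Hm HU Hg Hneg Hh Hper y Hy.
assert (HH : 0 <= H).
{ eapply Rle_trans; [apply Rabs_pos|apply (Hh y Hy)]. }
apply Rabs_le; split.
- assert (- g y <= H / m); [|lra].
  apply (linear_periodic_upper_bound U (fun y => - h y) (fun y => - g y) T);
    auto; [|intros z Hz; specialize (Hh z Hz); apply Rabs_le_between in Hh; lra
           |lra].
  intros z.
  replace (U z * - g z + - h z) with (- (U z * g z + h z)) by ring.
  apply (is_derive_opp g z _ (Hg z)).
- apply (linear_periodic_upper_bound U h g T); auto.
  intros z Hz; specialize (Hh z Hz); apply Rabs_le_between in Hh; lra.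
Qed.

(** Variation of constants; [exp (P T) / (1 - exp (P T)) * J T] is the only
    initial value for which the solution takes the same value at [0] and [T]. *)
Definition linear_periodic_solution (U h : R -> R) (T y : R) : R :=
  let P := fun z => RInt U 0 z in
  let J := fun z => RInt (fun s => h s * exp (- P s)) 0 z in
  exp (P y) * (exp (P T) / (1 - exp (P T)) * J T + J y).

Lemma linear_periodic_solution_derive U h T y :
  (forall z, continuous U z) -> (forall z, continuous h z) ->
  is_derive (linear_periodic_solution U h T) y
    (U y * linear_periodic_solution U h T y + h y).
Proof.
intros HU Hh; unfold linear_periodic_solution.
set (P := fun z => RInt U 0 z).
assert (HP : forall z, is_derive P z (U z)).
{ intros z; now apply is_derive_primitive. }
assert (CP : forall z, continuous (fun s => h s * exp (- P s)) z).
{ intros z; apply (continuous_mult h (fun s => exp (- P s))); [apply Hh|].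
  assert (DP : ex_derive P z) by (eexists; apply HP).
  apply @ex_derive_continuous; now auto_derive. }
set (J := fun z => RInt (fun s => h s * exp (- P s)) 0 z).
assert (HJ : is_derive J y (h y * exp (- P y))).
{ exact (is_derive_primitive (fun s => h s * exp (- P s)) y CP). }
change (is_derive
  (fun z => exp (P z) * (exp (P T) / (1 - exp (P T)) * J T + J z)) y
  (U y * (exp (P y) * (exp (P T) / (1 - exp (P T)) * J T + J y)) + h y)).
generalize (exp (P T) / (1 - exp (P T)) * J T); intros c.
assert (DP : ex_derive P y) by (eexists; apply HP).
assert (DJ : ex_derive J y) by (eexists; apply HJ).
auto_derive; [now repeat split|].
rewrite (Derive_eta P _ _ (HP y)), (Derive_eta J _ _ HJ).
rewrite exp_Ropp; field.
apply Rgt_not_eq, exp_pos.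
Qed.

Lemma linear_periodic_solution_periodic U h T :
  RInt U 0 T < 0 ->
  linear_periodic_solution U h T 0 = linear_periodic_solution U h T T.
Proof.
intros HU; unfold linear_periodic_solution.
assert (exp (RInt U 0 T) < 1) by (rewrite <- exp_0; now apply exp_increasing).
rewrite !RInt_point; change (@zero R_CompleteNormedModule) with 0.
rewrite exp_0; field; lra.
Qed.

(** * A contraction principle for bounded functions *)

(** The Banach fixed point theorem for the uniform distance, with the
    completeness of [P] phrased as closedness under uniform approximation. The
    iterates from [g0] are uniformly Cauchy, hence converge pointwise; letting
    one index tend to infinity in the Cauchy estimate makes the convergence
    uniform. *)
Lemma uniform_contraction_fixed_point (X : Type) (P : (X -> R) -> Prop)
  (A : (X -> R) -> X -> R) (g0 : X -> R) (M : R) :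
  P g0 ->
  (forall g, P g -> P (A g)) ->
  (forall x, Rabs (A g0 x - g0 x) <= M) ->
  (forall g h d, P g -> P h -> (forall x, Rabs (g x - h x) <= d) ->
     forall x, Rabs (A g x - A h x) <= d / 2) ->
  (forall g, (forall e, 0 < e ->
      exists h, P h /\ forall x, Rabs (h x - g x) <= e) -> P g) ->
  exists g, P g /\ forall x, A g x = g x.
Proof.
intros P0 PA HM Hc Hclosed.
set (s := fun k => Nat.iter k A g0).
assert (Ps : forall k, P (s k)).
{ induction k as [|k IH]; [exact P0|now apply PA]. }
assert (Hstep : forall k x, Rabs (s (S k) x - s k x) <= M * (/ 2) ^ k).
{ induction k as [|k IH]; intros x; [rewrite Rmult_1_r; apply HM|].
  replace (M * (/ 2) ^ S k) with (M * (/ 2) ^ k / 2) by (simpl; field).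
  apply (Hc (s (S k)) (s k)); auto. }
(* The subtracted term is the remaining geometric tail; it makes the induction
   on [j] go through. *)
assert (Htail : forall k j x,
  Rabs (s (k + j)%nat x - s k x) <= 2 * M * (/ 2) ^ k - 2 * M * (/ 2) ^ (k + j)).
{ intros k j x; induction j as [|j IH].
  - rewrite Nat.add_0_r, !Rminus_diag, Rabs_R0; lra.
  - rewrite Nat.add_succ_r.
    replace (s (S (k + j)) x - s k x)
      with ((s (S (k + j)) x - s (k + j)%nat x) + (s (k + j)%nat x - s k x)) by ring.
    eapply Rle_trans; [apply Rabs_triang|].
    specialize (Hstep (k + j)%nat x); rewrite <- tech_pow_Rmult; lra. }
assert (M0 : forall x : X, 0 <= M).
{ intros x; eapply Rle_trans; [apply Rabs_pos|apply (HM x)]. }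
assert (Htail' : forall k j x, Rabs (s (k + j)%nat x - s k x) <= 2 * M * (/ 2) ^ k).
{ intros k j x; eapply Rle_trans; [apply Htail|].
  assert (0 <= (/ 2) ^ (k + j)) by (apply pow_le; lra).
  specialize (M0 x); nra. }
assert (Hsmall : forall e, 0 < e -> exists k, 2 * M * (/ 2) ^ k <= e).
{ intros e He.
  assert (Hl : is_lim_seq (fun k => 2 * M * (/ 2) ^ k) (2 * M * 0)).
  { apply (is_lim_seq_scal_l (fun k => (/ 2) ^ k) (2 * M) 0), is_lim_seq_geom.
    rewrite Rabs_pos_eq; lra. }
  rewrite Rmult_0_r in Hl; apply is_lim_seq_spec in Hl.
  destruct (Hl (mkposreal e He)) as [k Hk]; exists k.
  specialize (Hk k (le_n k)); simpl in Hk.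
  apply Rabs_def2 in Hk; lra. }
assert (Hlim : forall x, is_lim_seq (fun k => s k x) (real (Lim_seq (fun k => s k x)))).
{ intros x; apply Lim_seq_correct', ex_lim_seq_cauchy_corr.
  intros [e He].
  destruct (Hsmall (e / 3) ltac:(lra)) as [k Hk]; exists k.
  intros i j Hi Hj; simpl.
  assert (Hi' := Htail' k (i - k)%nat x).
  assert (Hj' := Htail' k (j - k)%nat x).
  replace (k + (i - k))%nat with i in Hi' by lia.
  replace (k + (j - k))%nat with j in Hj' by lia.
  apply Rabs_le_between in Hi'; apply Rabs_le_between in Hj'.
  apply Rabs_def1; lra. }
set (g := fun x => real (Lim_seq (fun k => s k x))).
assert (Hg : forall k x, Rabs (s k x - g x) <= 2 * M * (/ 2) ^ k).
{ intros k x; rewrite Rabs_minus_sym.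
  apply (is_lim_seq_le (fun j => Rabs (s (k + j)%nat x - s k x))
    (fun _ => 2 * M * (/ 2) ^ k) (Rabs (g x - s k x)) (2 * M * (/ 2) ^ k)).
  - intros j; apply Htail'.
  - apply (is_lim_seq_abs (fun j => s (k + j)%nat x - s k x) (g x - s k x)).
    apply is_lim_seq_minus'; [|apply is_lim_seq_const].
    apply (is_lim_seq_ext (fun j => s (j + k)%nat x)).
    + intros j; f_equal; apply Nat.add_comm.
    + apply (is_lim_seq_incr_n (fun j => s j x)), Hlim.
  - apply is_lim_seq_const. }
assert (Pg : P g).
{ apply Hclosed; intros e He; destruct (Hsmall e He) as [k Hk].
  exists (s k); split; [apply Ps|].
  intros x; specialize (Hg k x); lra. }
exists g; split; [exact Pg|]; intros x.
apply Rminus_diag_uniq, Rabs_eq_0, Rle_antisym; [|apply Rabs_pos].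
apply le_epsilon; intros e He; rewrite Rplus_0_l.
destruct (Hsmall (e / 2) ltac:(lra)) as [k Hk].
assert (H1 := Hc (s k) g _ (Ps k) Pg (Hg k) x).
assert (H2 := Hg (S k) x).
change (s (S k) x) with (A (s k) x) in H2.
specialize (M0 x).
assert (0 <= (/ 2) ^ k) by (apply pow_le; lra).
simpl pow in H2.
apply Rabs_le_between in H1; apply Rabs_le_between in H2.
apply Rabs_le; nra.
Qed.

(** * The periodic problem for a Riccati equation *)

(** Retraction of the line onto [0, T]. Composing with it lets the fixed point
    argument run among functions continuous and bounded on the whole line,
    although the estimates hold only on [0, T]. *)
Definition clamp (T y : R) : R := Rmax 0 (Rmin T y).

Lemma clamp_range T y : 0 <= T -> 0 <= clamp T y <= T.
Proof.
intros HT; unfold clamp, Rmax, Rmin.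
repeat destruct (Rle_dec _ _); lra.
Qed.

Lemma clamp_id T y : 0 <= y <= T -> clamp T y = y.
Proof.
intros Hy; unfold clamp, Rmax, Rmin.
repeat destruct (Rle_dec _ _); lra.
Qed.

Lemma clamp_continuous T y : continuous (clamp T) y.
Proof.
apply filterlim_locally; intros e.
exists e; intros z Hz.
change (Rabs (clamp T z - clamp T y) < e).
change (Rabs (z - y) < e) in Hz.
eapply Rle_lt_trans; [|exact Hz].
unfold clamp, Rmax, Rmin, Rabs.
repeat destruct (Rle_dec _ _); repeat destruct (Rcase_abs _); lra.
Qed.

Lemma continuous_uniform_closed (g : R -> R) :
  (forall e, 0 < e -> exists h,
     (forall x, continuous h x) /\ forall x : R, Rabs (h x - g x) <= e) ->
  forall x, continuous g x.
Proof.
intros H x; apply filterlim_locally; intros [e He].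
destruct (H (e / 4) ltac:(lra)) as [h [Hh Hhg]].
assert (He2 : 0 < e / 4) by lra.
assert (Hc := proj1 (filterlim_locally h (h x)) (Hh x) (mkposreal _ He2)).
revert Hc; apply filter_imp; intros y Hy.
change (Rabs (h y - h x) < e / 4) in Hy.
change (Rabs (g y - g x) < e).
assert (H1 := Hhg x); assert (H2 := Hhg y).
apply Rabs_le_between in H1; apply Rabs_le_between in H2.
apply Rabs_def2 in Hy; apply Rabs_def1; lra.
Qed.

(** [K + delta / 2 * C ^ 2 <= m * C] says that the ball of radius [C] is mapped
    to itself by [linear_periodic_bound]; [delta * C <= m / 2] makes the map a
    contraction there, since [|g ^ 2 - h ^ 2| <= 2 * C * |g - h|]. The solution
    is returned as a function differentiable on the whole line, so that later
    differentiation at the endpoints [0] and [T] needs no special care. *)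
Lemma riccati_periodic (U Phi : R -> R) T m K C delta :
  0 < T -> 0 < m -> 0 <= delta -> 0 < C ->
  (forall y, continuous U y) -> (forall y, continuous Phi y) ->
  (forall y, 0 <= y <= T -> U y <= - m) ->
  (forall y, 0 <= y <= T -> Rabs (Phi y) <= K) ->
  K + delta / 2 * C ^ 2 <= m * C ->
  delta * C <= m / 2 ->
  exists g dg : R -> R,
    (forall y, is_derive g y (dg y)) /\
    (forall y, continuous dg y) /\
    (forall y, 0 <= y <= T -> dg y = U y * g y + Phi y + delta / 2 * g y ^ 2) /\
    g 0 = g T /\
    (forall y, 0 <= y <= T -> Rabs (g y) <= C).
Proof.
intros HT Hm Hdelta HC HU HPhi HUm HPhiK Hball Hcontr.
set (rhs := fun g y => Phi y + delta / 2 * g (clamp T y) ^ 2).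
set (A := fun g y => linear_periodic_solution U (rhs g) T (clamp T y)).
set (P := fun g => (forall y, continuous g y) /\ forall y : R, Rabs (g y) <= C).
assert (Hrhs : forall g, P g -> forall y, continuous (rhs g) y).
{ intros g [Hg _] y; unfold rhs.
  assert (Hgc : continuous (fun y => g (clamp T y)) y).
  { apply continuous_comp; [apply clamp_continuous|apply Hg]. }
  apply (continuous_plus Phi); [apply HPhi|].
  apply (continuous_mult (fun _ => delta / 2)); [apply continuous_const|].
  apply (continuous_ext (fun y => g (clamp T y) * g (clamp T y))).
  - intros z; simpl; ring.
  - now apply (continuous_mult (fun y => g (clamp T y))). }
assert (Hint : RInt U 0 T < 0) by now apply RInt_neg with m.
assert (Hsol : forall g, P g -> forall y, 0 <= y <= T ->
  Rabs (linear_periodic_solution U (rhs g) T y) <= C).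
{ intros g Hg y Hy.
  replace C with ((m * C) / m) by (field; lra).
  apply (linear_periodic_bound U (rhs g)) with T; auto.
  - intros z; apply linear_periodic_solution_derive; auto.
  - intros z Hz; unfold rhs.
    eapply Rle_trans; [apply Rabs_triang|].
    eapply Rle_trans; [|exact Hball].
    apply Rplus_le_compat; [now apply HPhiK|].
    rewrite Rabs_mult, Rabs_pos_eq by lra.
    apply Rmult_le_compat_l; [lra|].
    rewrite <- RPow_abs; apply pow_incr; split; [apply Rabs_pos|apply Hg].
  - now apply linear_periodic_solution_periodic. }
assert (HA : forall g, P g -> P (A g)).
{ intros g Hg; split.
  - intros y; apply (continuous_comp (clamp T)); [apply clamp_continuous|].
    apply @ex_derive_continuous; eexists.
    apply linear_periodic_solution_derive; auto.
  - intros y; apply Hsol; [exact Hg|apply clamp_range; lra]. }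
destruct (uniform_contraction_fixed_point R P A (fun _ => 0) C) as [g [Hg Hfix]].
- split; [intros y; apply continuous_const|].
  intros y; rewrite Rabs_R0; lra.
- exact HA.
- intros y; rewrite Rminus_0_r; apply HA; split.
  + intros z; apply continuous_const.
  + intros z; rewrite Rabs_R0; lra.
- intros g h d Hg Hh Hd y.
  assert (d0 : 0 <= d).
  { eapply Rle_trans; [apply Rabs_pos|apply (Hd 0)]. }
  replace (d / 2) with ((m / 2 * d) / m) by (field; lra).
  apply (linear_periodic_bound U (fun y => rhs g y - rhs h y)
    (fun y => linear_periodic_solution U (rhs g) T y
              - linear_periodic_solution U (rhs h) T y)) with T; auto.
  + intros z.
    replace (U z * _ + _)
      with ((U z * linear_periodic_solution U (rhs g) T z + rhs g z)
            - (U z * linear_periodic_solution U (rhs h) T z + rhs h z)) by ring.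
    apply @is_derive_minus; apply linear_periodic_solution_derive; auto.
  + intros z Hz; unfold rhs.
    set (w := clamp T z).
    replace (_ - _) with (delta / 2 * ((g w + h w) * (g w - h w))) by ring.
    rewrite Rabs_mult, (Rabs_pos_eq (delta / 2)), Rabs_mult by lra.
    assert (Hs : Rabs (g w + h w) <= 2 * C).
    { eapply Rle_trans; [apply Rabs_triang|].
      destruct Hg as [_ Hg], Hh as [_ Hh].
      specialize (Hg w); specialize (Hh w); lra. }
    assert (Hp : Rabs (g w + h w) * Rabs (g w - h w) <= 2 * C * d).
    { apply Rmult_le_compat; auto using Rabs_pos. }
    apply Rle_trans with (delta / 2 * (2 * C * d)).
    * apply Rmult_le_compat_l; [lra|exact Hp].
    * nra.
  + now rewrite <- !linear_periodic_solution_periodic.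
  + apply clamp_range; lra.
- intros g Hg; split.
  + apply continuous_uniform_closed; intros e He.
    destruct (Hg e He) as [h [[Hh _] Hhg]]; exists h; now split.
  + intros y; apply le_epsilon; intros e He.
    destruct (Hg e He) as [h [[_ Hh] Hhg]].
    specialize (Hh y); specialize (Hhg y).
    apply Rabs_le_between in Hh; apply Rabs_le_between in Hhg.
    apply Rabs_le; lra.
(* [g] is constant outside [0, T]; the unclamped solution [G] agrees with it
   on [0, T] and is differentiable everywhere. *)
- set (G := linear_periodic_solution U (rhs g) T).
  assert (HG : forall y, is_derive G y (U y * G y + rhs g y)).
  { intros y; apply linear_periodic_solution_derive; auto. }
  exists G, (fun y => U y * G y + rhs g y).
  split; [exact HG|split; [|split; [|split]]].
  + intros y; apply (continuous_plus (fun y => U y * G y)); [|now apply Hrhs].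
    apply (continuous_mult U); [apply HU|].
    apply @ex_derive_continuous; eexists; apply HG.
  + intros y Hy; unfold rhs; rewrite <- (Hfix (clamp T y)); unfold A.
    rewrite !(clamp_id T y Hy); fold G; ring.
  + now apply linear_periodic_solution_periodic.
  + intros y Hy; now apply Hsol.
Qed.

(** * Application to the equation *)

Lemma D_in_of_is_derive (f df : R -> R) l D y :
  is_derive f y l -> df y = l -> D_in f df D y.
Proof.
intros Hf <-.
apply is_derive_Reals, derivable_pt_lim_D_in in Hf.
intros e He; destruct (Hf e He) as [d [Hd H]].
exists d; split; [exact Hd|].
intros z [[Hz1 Hz2] Hz3]; apply H; repeat split; auto.
Qed.

Lemma continue_in_of_continuous (f : R -> R) D y : continuous f y -> continue_in f D y.
Proof.
intros Hf; apply continuity_pt_filterlim in Hf.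
intros e He; destruct (Hf e He) as [d [Hd H]].
exists d; split; [exact Hd|].
intros z [[Hz1 Hz2] Hz3]; apply H; repeat split; auto.
Qed.

(** The first derivative is taken to be the Riccati right-hand side, which is a
    differentiable expression in [g]; it coincides with [dg] on [0, T], and
    differentiating it there gives the second-order equation. *)
Lemma second_order_of_riccati (U dU Fe Phi g dg : R -> R) T delta :
  (forall y, is_derive U y (dU y)) -> (forall y, continuous dU y) ->
  (forall y, is_derive Phi y (Fe y)) -> (forall y, continuous Fe y) ->
  (forall y, is_derive g y (dg y)) -> (forall y, continuous dg y) ->
  (forall y, 0 <= y <= T -> dg y = U y * g y + Phi y + delta / 2 * g y ^ 2) ->
  exists g1 g2, C2_on 0 T g g1 g2 /\
    forall y, 0 <= y <= T ->
      - g2 y + delta * g y * g1 y + U y * g1 y + dU y * g y + Fe y = 0.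
Proof.
intros HU CdU HPhi CFe Hg Cdg Hric.
exists (fun y => U y * g y + Phi y + delta / 2 * g y ^ 2).
exists (fun y => delta * g y * dg y + U y * dg y + dU y * g y + Fe y).
assert (CU : forall y, continuous U y).
{ intros y; apply @ex_derive_continuous; eexists; apply HU. }
assert (Cg : forall y, continuous g y).
{ intros y; apply @ex_derive_continuous; eexists; apply Hg. }
split.
- intros y Hy; split; [|split].
  + apply D_in_of_is_derive with (dg y); [apply Hg|]; now rewrite Hric.
  + eapply D_in_of_is_derive; [|reflexivity].
    assert (ex_derive U y) by (eexists; apply HU).
    assert (ex_derive g y) by (eexists; apply Hg).
    assert (ex_derive Phi y) by (eexists; apply HPhi).
    auto_derive; [now repeat split|].
    rewrite (Derive_eta U _ _ (HU y)), (Derive_eta g _ _ (Hg y)),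
      (Derive_eta Phi _ _ (HPhi y)); field.
  + apply continue_in_of_continuous.
    apply (continuous_plus (fun y => delta * g y * dg y + U y * dg y + dU y * g y) Fe);
      [|apply CFe].
    apply (continuous_plus (fun y => delta * g y * dg y + U y * dg y)
      (fun y => dU y * g y)); [|now apply (continuous_mult dU g)].
    apply (continuous_plus (fun y => delta * g y * dg y) (fun y => U y * dg y));
      [|now apply (continuous_mult U dg)].
    apply (continuous_mult (fun y => delta * g y) dg); [|apply Cdg].
    apply (continuous_mult (fun _ => delta) g); [apply continuous_const|apply Cg].
- intros y Hy; rewrite <- Hric by exact Hy; ring.
Qed.

Lemma remainder_F_differentiable u n eps N :
  (forall k N, differentiable_times N (u k)) ->
  differentiable_times N (remainder_F u n eps).
Proof.
intros Hu.
replace (remainder_F u n eps) with (fun x =>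
  sum_n_m (fun k => eps ^ k *
    sum_n_m (fun j => u j x * Derive (u (n + k - j)%nat) x) k n) 1 n
  + (- eps) * Derive (Derive (u n)) x).
- apply differentiable_times_plus.
  + apply (differentiable_times_sum N (fun k x => eps ^ k *
      sum_n_m (fun j => u j x * Derive (u (n + k - j)%nat) x) k n)).
    intros k _; apply differentiable_times_mult; [apply differentiable_times_const|].
    apply (differentiable_times_sum N
      (fun j x => u j x * Derive (u (n + k - j)%nat) x)).
    intros j _; apply differentiable_times_mult; [apply Hu|].
    exact (proj2 (Hu (n + k - j)%nat (S N))).
  + apply differentiable_times_mult; [apply differentiable_times_const|].
    exact (proj2 (proj2 (Hu n (S (S N))))).
- extensionality x; unfold remainder_F; simpl Derive_n.
  change (Derive (fun x => Derive (fun x0 => u n x0) x) x)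
    with (Derive (Derive (u n)) x); ring.
Qed.

(** The integral of [remainder_F] over an interval of length of order [1 / eps]
    thus stays bounded. *)
Lemma remainder_F_bound u n a b :
  a <= b -> (forall k N, differentiable_times N (u k)) ->
  exists B, 0 <= B /\ forall eps x, 0 <= eps <= 1 -> a <= x <= b ->
    Rabs (remainder_F u n eps x) <= eps * B.
Proof.
intros ab Hu.
destruct (eps_sum_bound (fun k x =>
  sum_n_m (fun j => u j x * Derive (u (n + k - j)%nat) x) k n) a b n ab)
  as [B1 [B10 HB1]].
{ intros k; apply differentiable_times_continuous.
  apply (differentiable_times_sum 1
      (fun j x => u j x * Derive (u (n + k - j)%nat) x)).
  intros j _; apply differentiable_times_mult; [apply Hu|].
  exact (proj2 (Hu (n + k - j)%nat 2%nat)). }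
destruct (continuous_bounded (Derive_n (u n) 2) a b ab) as [B2 [B20 HB2]].
{ apply (differentiable_times_continuous (Derive (Derive (u n)))).
  exact (proj2 (proj2 (Hu n 3%nat))). }
exists (B1 + B2); split; [lra|]; intros eps x He Hx.
specialize (HB1 eps x He Hx); specialize (HB2 x Hx).
unfold remainder_F.
eapply Rle_trans; [apply Rabs_triang|].
rewrite Rabs_Ropp, Rabs_mult, (Rabs_pos_eq eps) by lra; nra.
Qed.

(** [m] is half of the minimum of [- u 0]; the other half absorbs the terms of
    positive order in [eps]. *)
Lemma truncated_sum_negative u n a b :
  a <= b -> (forall k N, differentiable_times N (u k)) ->
  (forall x, u 0%nat x < 0) ->
  exists m eps0, 0 < m /\ 0 < eps0 /\
    forall eps x, 0 <= eps <= eps0 -> a <= x <= b ->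
      sum_n_m (fun k => eps ^ k * u k x) 0 n <= - m.
Proof.
intros ab Hu Hneg.
assert (Cu : forall k x, continuous (u k) x).
{ intros k; apply differentiable_times_continuous, Hu. }
destruct (continuity_ab_maj (u 0%nat) a b ab) as [x0 [Hx0 _]].
{ intros c _; apply continuity_pt_filterlim, Cu. }
destruct (eps_sum_bound u a b n ab Cu) as [B [B0 HB]].
specialize (Hneg x0).
set (m := - u 0%nat x0 / 2).
assert (Hm : 0 < m) by (unfold m; lra).
exists m, (Rmin 1 (m / (B + 1))); split; [exact Hm|split].
- apply Rmin_glb_lt; [lra|apply Rdiv_lt_0_compat; lra].
- intros eps x He Hx.
  assert (He1 : eps <= 1) by (eapply Rle_trans; [apply He|apply Rmin_l]).
  assert (He2 : eps <= m / (B + 1)) by (eapply Rle_trans; [apply He|apply Rmin_r]).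
  apply (Rmult_le_compat_r (B + 1)) in He2; [|lra].
  replace (m / (B + 1) * (B + 1)) with m in He2 by (field; lra).
  specialize (HB eps x ltac:(lra) Hx); apply Rabs_le_between in HB.
  specialize (Hx0 x Hx).
  rewrite sum_Sn_m by lia; change plus with Rplus; simpl pow at 1.
  unfold m in *; nra.
Qed.

Theorem theorem1p4 (f u0 : R -> R) (u : nat -> R -> R) (n : nat)
  (f_smooth : smooth f) (f_periodic : periodic2PI f)
  (f_mean : is_RInt f 0 (2 * PI) 0)
  (u0_smooth : smooth u0) (u0_periodic : periodic2PI u0)
  (u0_neg : forall x : R, u0 x < 0)
  (u0_eq : forall x : R, u0 x * Derive u0 x = f x)
  (n_pos : (1 <= n)%nat)
  (u_def : expansion_coeffs u0 u) :
  exists eps0 C : R, 0 < eps0 /\ 0 < C /\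
    forall eps : R, 0 < eps < eps0 ->
      exists g g1 g2 : R -> R,
        C2_on 0 (2 * PI / eps) g g1 g2 /\
        (forall y : R, 0 <= y <= 2 * PI / eps ->
           - g2 y
           + eps ^ (n + 1) * g y * g1 y
           + sum_n_m (fun k : nat => eps ^ k * u k (eps * y)) 0 n * g1 y
           + sum_n_m (fun k : nat =>
               eps ^ (k + 1) * Derive (u k) (eps * y)) 0 n * g y
           + remainder_F u n eps (eps * y) = 0) /\
        g 0 = g (2 * PI / eps) /\
        (forall y : R, 0 <= y <= 2 * PI / eps -> Rabs (g y) <= C).
Proof.
assert (Hu := expansion_coeffs_differentiable u0 u u0_smooth u0_neg u_def).
assert (Hpi := PI_RGT_0).
destruct (truncated_sum_negative u n 0 (2 * PI) ltac:(lra) Hu)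
  as (m & em & Hm & Hem & HUm).
{ intros x; rewrite (proj1 u_def); apply u0_neg. }
destruct (remainder_F_bound u n 0 (2 * PI) ltac:(lra) Hu) as (B & HB0 & HB).
set (K := 2 * PI * B).
assert (HK : 0 <= K) by (unfold K; nra).
(* The [1] in [K + 1] is the room for the quadratic term: the three quantities
   compared with [eps] in [e0], beyond [1], ensure respectively [U <= - m],
   [delta / 2 * C ^ 2 <= 1] and [delta * C <= m / 2]. *)
set (C := (K + 1) / m).
assert (HC : 0 < C) by (apply Rdiv_lt_0_compat; lra).
assert (HmC : m * C = K + 1) by (unfold C; field; lra).
set (e0 := Rmin (Rmin 1 em) (Rmin (2 / C ^ 2) (m / (2 * C)))).
assert (HC2 : 0 < C ^ 2) by (apply pow_lt; exact HC).
exists e0, C; split; [|split; [exact HC|]].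
{ repeat apply Rmin_glb_lt; try lra; apply Rdiv_lt_0_compat; lra. }
intros eps [Heps Hlt].
assert (He : eps <= 1 /\ eps <= em /\ eps <= 2 / C ^ 2 /\ eps <= m / (2 * C)).
{ unfold e0 in Hlt.
  assert (H1 := Rmin_l (Rmin 1 em) (Rmin (2 / C ^ 2) (m / (2 * C)))).
  assert (H2 := Rmin_r (Rmin 1 em) (Rmin (2 / C ^ 2) (m / (2 * C)))).
  assert (H3 := Rmin_l 1 em). assert (H4 := Rmin_r 1 em).
  assert (H5 := Rmin_l (2 / C ^ 2) (m / (2 * C))).
  assert (H6 := Rmin_r (2 / C ^ 2) (m / (2 * C))).
  lra. }
destruct He as (He1 & Hem' & HeC2 & HeC).
apply (Rmult_le_compat_r (C ^ 2)) in HeC2; [|lra].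
replace (2 / C ^ 2 * C ^ 2) with 2 in HeC2 by (field; lra).
apply (Rmult_le_compat_r C) in HeC; [|lra].
replace (m / (2 * C) * C) with (m / 2) in HeC by (field; lra).
set (delta := eps ^ (n + 1)).
assert (Hdelta : 0 <= delta <= eps).
{ unfold delta; rewrite Nat.add_1_r; simpl.
  assert (0 <= eps ^ n) by (apply pow_le; lra).
  assert (eps ^ n <= 1) by (rewrite <- (pow1 n); apply pow_incr; lra).
  nra. }
set (T := 2 * PI / eps).
assert (HT : 0 < T) by (apply Rdiv_lt_0_compat; lra).
assert (HeT : eps * T = 2 * PI) by (unfold T; field; lra).
set (U := fun y => sum_n_m (fun k => eps ^ k * u k (eps * y)) 0 n).
set (dU := fun y => sum_n_m (fun k => eps ^ (k + 1) * Derive (u k) (eps * y)) 0 n).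
set (Fe := fun y => remainder_F u n eps (eps * y)).
set (Phi := fun y => RInt Fe 0 y).
assert (Hscale : forall y, continuous (fun y => eps * y) y).
{ intros y; apply (continuous_mult (fun _ => eps) (fun y => y));
    [apply continuous_const|apply continuous_id]. }
assert (HU : forall y, is_derive U y (dU y)).
{ intros y.
  apply (is_derive_sum_n (fun k y => eps ^ k * u k (eps * y)) n y
    (fun k => eps ^ (k + 1) * Derive (u k) (eps * y))).
  intros k _.
  assert (ex_derive (u k) (eps * y)) by apply (Hu k 1%nat).
  auto_derive; [now repeat split|].
  rewrite pow_add; change (fun x => u k x) with (u k); ring. }
assert (CdU : forall y, continuous dU y).
{ intros y; apply (continuous_comp (fun y => eps * y)
    (fun x => sum_n_m (fun k => eps ^ (k + 1) * Derive (u k) x) 0 n)); [apply Hscale|].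
  apply differentiable_times_continuous.
  apply (differentiable_times_sum 1 (fun k x => eps ^ (k + 1) * Derive (u k) x)).
  intros k _; apply differentiable_times_mult; [apply differentiable_times_const|].
  exact (proj2 (Hu k 2%nat)). }
assert (CFe : forall y, continuous Fe y).
{ intros y; apply (continuous_comp (fun y => eps * y)); [apply Hscale|].
  now apply differentiable_times_continuous, remainder_F_differentiable. }
assert (HPhi : forall y, is_derive Phi y (Fe y)).
{ intros y; now apply is_derive_primitive. }
assert (Hrange : forall y, 0 <= y <= T -> 0 <= eps * y <= 2 * PI).
{ intros y Hy; rewrite <- HeT; nra. }
assert (HPhiK : forall y, 0 <= y <= T -> Rabs (Phi y) <= K).
{ intros y Hy.
  apply Rle_trans with ((y - 0) * (eps * B)).
  - apply abs_RInt_le_const; [lra|now apply @ex_RInt_continuous|].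
    intros t Ht; apply HB; [lra|apply Hrange; lra].
  - specialize (Hrange y Hy); unfold K; nra. }
destruct (riccati_periodic U Phi T m K C delta)
  as (g & dg & Hg & Cdg & Hric & Hper & Hbound); auto; try lra.
{ intros y; apply @ex_derive_continuous; eexists; apply HU. }
{ intros y; apply @ex_derive_continuous; eexists; apply HPhi. }
{ intros y Hy; apply (HUm eps (eps * y)); [lra|now apply Hrange]. }
{ nra. }
{ nra. }
destruct (second_order_of_riccati U dU Fe Phi g dg T delta) as (g1 & g2 & HC2g & Heq);
  auto.
exists g, g1, g2; exact (conj HC2g (conj Heq (conj Hper Hbound))).
Qed.
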